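(* Let $\mathcal{U}$ be a widely closed subcategory of $\mathcal{G}$, and suppose that $G,H\in\mathcal{U}$. Then $e_G\otimes e_H$ is naturally isomorphic to $F(\underline{W}(G,H))$ (and so is a finitely generated projective object of $\mathcal{A}\mathcal{U}$).
   Context: Fix a field $k$ of characteristic zero. $\mathcal{G}$ is the category whose objects are finite groups and whose morphisms are conjugacy classes of surjective group homomorphisms. A subcategory of $\mathcal{G}$ is always full and replete. For $\mathcal{U}\le\mathcal{G}$, $\mathcal{A}\mathcal{U}=[\mathcal{U}^{\mathrm{op}},\mathrm{Vect}_k]$, with tensor product $(X\otimes Y)(T)=X(T)\otimes_kY(T)$. For $G\in\mathcal{U}$, $e_G(T)=k[\mathcal{U}(T,G)]$. An object $X$ is finitely generated if it is a quotient of a finite direct sum of objects $e_{G_i}$, $G_i\in\mathcal{U}$. $\mathcal{U}$ is widely closed if whenever $G\leftarrow H\to K$ are surjective homomorphisms with $G,H,K\in\mathcal{U}$, the image of the combined homomorphism $H\to G\times K$ is also in $\mathcal{U}$. $\operatorname{Epi}(T,G)$ is the set of surjective homomorphisms $T\to G$. A permuted family consists of a finite group $\Gamma$, a finite $\Gamma$-set $A$, groups $G_a\in\mathcal{U}$ for $a\in A$, and isomorphisms $\gamma_*\colon G_a\to G_{\gamma(a)}$ for $\gamma\in\Gamma$, $a\in A$, with $1_*=1$ and $(\delta\gamma)_*=\delta_*\gamma_*$. It is outer if for each $a$ the image of the resulting map $\operatorname{stab}_\Gamma(a)\to\operatorname{Aut}(G_a)$ contains the inner automorphism group of $G_a$.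 For an outer permuted family $\underline{G}$, put $\widetilde{B}(\underline{G})(T)=\{(a,\alpha)\mid a\in A,\ \alpha\in\operatorname{Epi}(T,G_a)\}$ with $\Gamma$-action $\gamma\cdot(a,\alpha)=(\gamma(a),\gamma_*\circ\alpha)$, $B(\underline{G})(T)=\widetilde{B}(\underline{G})(T)/\Gamma$, and $F(\underline{G})(T)=k[B(\underline{G})(T)]$; this is contravariantly functorial in $T$ by precomposition, so $F(\underline{G})\in\mathcal{A}\mathcal{U}$. A subgroup $W\le G\times H$ is wide if both projections $W\to G$ and $W\to H$ are surjective. $\operatorname{Wide}(G,H)$ is the set of wide subgroups of $G\times H$ which belong to $\mathcal{U}$. $\underline{W}(G,H)$ is the tautological family indexed by $\operatorname{Wide}(G,H)$ (the group indexed by $U$ is $U$ itself), regarded as an outer permuted family with $\Gamma=G\times H$ acting by conjugation. *)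

(* Defs.v *)
From HB Require Import structures.
From mathcomp Require Import all_boot all_order all_algebra all_fingroup.
From mathcomp Require Import generic_quotient ring_quotient boolp freeg.

Set Implicit Arguments.
Unset Strict Implicit.
Unset Printing Implicit Defensive.

Import GRing.Theory.

Local Open Scope ring_scope.
Local Open Scope quotient_scope.

Record submodule (k : fieldType) (V : lmodType k) := Submodule {
  submod_mem :> {pred V};
  submod_memP : submod_closed submod_mem
}.
HB.instance Definition _ (k : fieldType) (V : lmodType k) (S : submodule V) :=
  GRing.isSubmodClosed.Build k V (submod_mem S) (submod_memP S).

Section QuotientModule.
Variables (k : fieldType) (V : lmodType k) (S : submodule V).

(* ring_quotient only gives V / S as a zmodType; scaling is added here. *)
Definition quot_mod := Quotient.quot (submod_mem S).
HB.instance Definition _ := GRing.Zmodule.on quot_mod.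

Definition quot_pi (v : V) : quot_mod := \pi_(quot_mod) v.

Lemma quot_piP (v w : V) : reflect (quot_pi v = quot_pi w) (v - w \in S).
Proof. by rewrite Quotient.idealrBE; apply: eqP. Qed.

Lemma quot_piK (x : quot_mod) : quot_pi (repr x) = x.
Proof. exact: reprK. Qed.

Lemma quot_piB : zmod_morphism quot_pi.
Proof. by move=> v w; rewrite /quot_pi !piE. Qed.

Lemma quot_piD v w : quot_pi (v + w) = quot_pi v + quot_pi w.
Proof. by rewrite /quot_pi !piE. Qed.

Definition quot_scale (a : k) (x : quot_mod) : quot_mod := quot_pi (a *: repr x).

Lemma quot_scale_pi a v : quot_scale a (quot_pi v) = quot_pi (a *: v).
Proof.
apply/quot_piP; rewrite -scalerBr rpredZ //.
by apply/quot_piP; rewrite quot_piK.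
Qed.

Fact quot_scaleA a b x : quot_scale a (quot_scale b x) = quot_scale (a * b) x.
Proof. by rewrite -[x]quot_piK !quot_scale_pi scalerA. Qed.
Fact quot_scale1 : left_id 1 quot_scale.
Proof. by move=> x; rewrite -[x]quot_piK quot_scale_pi scale1r. Qed.
Fact quot_scaleDr : right_distributive quot_scale +%R.
Proof.
move=> a x y; rewrite -[x]quot_piK -[y]quot_piK.
by rewrite -quot_piD !quot_scale_pi -quot_piD scalerDr.
Qed.
Fact quot_scaleDl x : {morph quot_scale^~ x : a b / a + b}.
Proof.
by move=> a b; rewrite -[x]quot_piK !quot_scale_pi -quot_piD scalerDl.
Qed.
HB.instance Definition _ := GRing.Zmodule_isLmodule.Build k quot_mod
  quot_scaleA quot_scale1 quot_scaleDr quot_scaleDl.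

HB.instance Definition _ :=
  GRing.isZmodMorphism.Build V quot_mod quot_pi quot_piB.
HB.instance Definition _ := GRing.isScalable.Build k V quot_mod *:%R quot_pi
  (fun a v => esym (quot_scale_pi a v)).

End QuotientModule.

Section Freeg.
Variables (k : fieldType) (K : choiceType).

Definition fg_gen (x : K) : {freeg K / k} := [freeg [:: (1, x)]].

Variables (M : lmodType k) (f : K -> M).

Lemma fglift_linear : linear (fglift f).
Proof.
have fB : zmod_morphism (fglift f) := lift_is_additive f.
have fD x y : fglift f (x + y) = fglift f x + fglift f y.
  have f0 : fglift f 0 = 0 by rewrite -[in LHS](subrr 0) fB subrr.
  by rewrite -{1}[y]opprK fB -[- y]sub0r fB f0 sub0r opprK.
have f0 : fglift f 0 = 0 by rewrite -[in LHS](subrr 0) fB subrr.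
have fE z : fglift f z = \sum_(t <- dom z) coeff t z *: f t.
  rewrite -[in LHS](freeg_sumE z) (big_morph (fglift f) fD f0).
  by apply: eq_bigr => t _; rewrite liftU.
move=> a x y; rewrite fD; congr (_ + _).
rewrite [in RHS]fE scaler_sumr.
have -> : a *: x = \sum_(t <- dom x) [freeg [:: (a * coeff t x, t)]] by [].
rewrite (big_morph (fglift f) fD f0).
by apply: eq_bigr => t _; rewrite liftU scalerA.
Qed.
HB.instance Definition _ :=
  GRing.isLinear.Build k {freeg K / k} M *:%R (fglift f) fglift_linear.

Lemma fglift_gen x : fglift f (fg_gen x) = f x.
Proof. by rewrite liftU scale1r. Qed.

Lemma fglift_unique (g : {linear {freeg K / k} -> M}) :
  (forall x, g (fg_gen x) = f x) -> g =1 fglift f.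
Proof.
move=> gE x; rewrite -[x]freeg_sumE !linear_sum; apply: eq_bigr => z _.
have -> : [freeg [:: (coeff z x, z)]] = coeff z x *: fg_gen z.
  by apply/eqP/freeg_eqP => t; rewrite coeffZ !coeffU mul1r.
by rewrite !linearZ /= gE fglift_gen.
Qed.

End Freeg.

Section Tensor.
Variables (k : fieldType) (V W : lmodType k).

Local Notation gen v w := (fg_gen k (v : V, w : W)).

(* The subspace of k[V * W] spanned by the bilinearity relations. *)
Inductive tens_null : {freeg (V * W)%type / k} -> Prop :=
| tens_null0 : tens_null 0
| tens_nullP a x y : tens_null x -> tens_null y -> tens_null (a *: x + y)
| tens_nullL a v v' w :
    tens_null (gen (a *: v + v') w - (a *: gen v w + gen v' w))
| tens_nullR a v w w' :
    tens_null (gen v (a *: w + w') - (a *: gen v w + gen v w')).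

Definition tens_nullb : {pred {freeg (V * W)%type / k}} :=
  fun x => `[< tens_null x >].

Fact tens_null_submod : submod_closed tens_nullb.
Proof.
split=> [|a x y]; rewrite !unfold_in; first exact/asboolP/tens_null0.
by move=> /asboolP nx /asboolP ny; apply/asboolP/tens_nullP.
Qed.

Definition tens_rel := Submodule tens_null_submod.

Definition tensor := quot_mod tens_rel.
HB.instance Definition _ := GRing.Lmodule.on tensor.

Definition tens (v : V) (w : W) : tensor := quot_pi tens_rel (gen v w).

Fact tens_bilinear : bilinear_for *:%R *:%R tens.
Proof.
split=> [w a v v'|v a w w']; rewrite /= /applyr /tens -linearP;
  apply/quot_piP; rewrite unfold_in; apply/asboolP; constructor.
Qed.
HB.instance Definition _ :=
  bilinear_isBilinear.Build k V W tensor *:%R *:%R tens tens_bilinear.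

End Tensor.

Section TensorLift.
Variables (k : fieldType) (V W Z : lmodType k).

Lemma tensor_ext (f g : {linear tensor V W -> Z}) :
  (forall v w, f (tens v w) = g (tens v w)) -> f =1 g.
Proof.
move=> fg x; rewrite -[x]quot_piK.
pose h (p : V * W) := g (tens p.1 p.2).
have fh := @fglift_unique k _ _ h (f \o @quot_pi _ _ (tens_rel V W)).
have gh := @fglift_unique k _ _ h (g \o @quot_pi _ _ (tens_rel V W)).
rewrite [LHS]fh ?[RHS]gh // => -[v w] //=; exact: fg.
Qed.

Variable b : {bilinear V -> W -> Z}.

Let lift0 := fglift (fun p : V * W => b p.1 p.2).

Lemma tens_null_lift x : tens_null x -> lift0 x = 0.
Proof.
rewrite /lift0; elim=> [|a {}x y _ x0 _ y0|a v v' w|a v w w'].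
- by rewrite linear0.
- by rewrite linearP /= x0 y0 scaler0 addr0.
- by rewrite linearB linearP /= !fglift_gen linearPl subrr.
- by rewrite linearB linearP /= !fglift_gen linearPr subrr.
Qed.

Definition tens_lift (x : tensor V W) : Z := lift0 (repr x).

Lemma tens_lift_pi x : tens_lift (quot_pi (tens_rel V W) x) = lift0 x.
Proof.
apply/eqP; rewrite -subr_eq0 /tens_lift /lift0 -linearB; apply/eqP.
apply/tens_null_lift/asboolP.
by have /quot_piP := quot_piK (quot_pi (tens_rel V W) x).
Qed.

Lemma tens_lift_linear : linear tens_lift.
Proof.
move=> a x y; rewrite -[x]quot_piK -[y]quot_piK -linearP !tens_lift_pi.
by rewrite /lift0 linearP.
Qed.
HB.instance Definition _ :=
  GRing.isLinear.Build k (tensor V W) Z *:%R tens_lift tens_lift_linear.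

Lemma tens_liftE v w : tens_lift (tens v w) = b v w.
Proof. by rewrite tens_lift_pi /lift0 fglift_gen. Qed.

End TensorLift.

Section TensorMap.
Variables (k : fieldType) (V V' W W' : lmodType k).
Variables (f : {linear V -> V'}) (g : {linear W -> W'}).

Definition tens_comp (v : V) (w : W) : tensor V' W' := tens (f v) (g w).

Fact tens_comp_bilinear : bilinear_for *:%R *:%R tens_comp.
Proof.
by split=> [w a v v'|v a w w'] /=; rewrite /tens_comp /applyr linearP
  (linearPl, linearPr).
Qed.
HB.instance Definition _ := bilinear_isBilinear.Build k V W (tensor V' W')
  *:%R *:%R tens_comp tens_comp_bilinear.

Definition tens_map : {linear tensor V W -> tensor V' W'} := tens_lift tens_comp.

Lemma tens_mapE v w : tens_map (tens v w) = tens (f v) (g w).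
Proof. exact: tens_liftE. Qed.

End TensorMap.

Section FreeModule.
Variable k : fieldType.

(* For a finite set S, k[S] is represented by the functions S -> k, the basis
   element s being the indicator function of s. A map f : S -> S' sends the
   basis element s to the basis element f s. *)
Definition free_push (S S' : finType) (f : S -> S') (x : {ffun S -> k^o}) :
  {ffun S' -> k^o} := [ffun s' => \sum_(s | f s == s') x s].

Fact free_push_linear (S S' : finType) (f : S -> S') : linear (free_push f).
Proof.
move=> a x y; apply/ffunP => s'; rewrite !ffunE.
by rewrite scaler_sumr -big_split; apply: eq_bigr => s _; rewrite !ffunE.
Qed.
HB.instance Definition _ (S S' : finType) (f : S -> S') :=
  GRing.isLinear.Build k {ffun S -> k^o} {ffun S' -> k^o} *:%R (free_push f)
    (free_push_linear f).

Lemma free_push_id (S : finType) (f : S -> S) : f =1 id -> free_push f =1 id.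
Proof.
by move=> fE x; apply/ffunP => s; rewrite ffunE (big_pred1 s) // => t; rewrite fE.
Qed.

Lemma free_push_comp (S S' S'' : finType) (f : S -> S') (g : S' -> S'') h :
  h =1 g \o f -> free_push h =1 free_push g \o free_push f.
Proof.
move=> hE x; apply/ffunP => s; rewrite !ffunE.
rewrite (partition_big f (fun t => g t == s)) /= => [|t]; last by rewrite hE.
apply: eq_bigr => t /eqP gt; rewrite ffunE; apply: eq_bigl => u.
by rewrite hE /=; have [->|] := eqVneq (f u) t; rewrite ?andbF // gt eqxx.
Qed.

End FreeModule.

Section Epi.
Local Open Scope group_scope.

Definition is_epi (T G : finGroupType) (f : {ffun T -> G}) :=
  morphic [set: T] f && (f @: [set: T] == [set: G]).

Record epi (T G : finGroupType) := Epi {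
  epi_fun :> {ffun T -> G};
  epi_funP : is_epi epi_fun
}.
HB.instance Definition _ T G := [isSub for @epi_fun T G].
HB.instance Definition _ T G := [Finite of epi T G by <:].

Lemma epiM (T G : finGroupType) (f : epi T G) : {morph f : x y / x * y}.
Proof.
case: f => f /= fP x y; have [/morphicP fM _] := andP fP; exact: fM (in_setT x) (in_setT y).
Qed.

Lemma epi1 (T G : finGroupType) (f : epi T G) : f 1 = 1.
Proof. by apply: (mulgI (f 1)); rewrite mulg1 -epiM mul1g. Qed.

Lemma epiJ (T G : finGroupType) (f : epi T G) : {morph f : x y / x ^ y}.
Proof.
move=> x y; rewrite !conjgE !epiM; congr (_ * _).
by apply: (mulgI (f y)); rewrite mulgV -epiM mulgV epi1.
Qed.

Lemma epi_surj (T G : finGroupType) (f : epi T G) y : exists x, f x = y.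
Proof.
case: f => f /= fP; have [_ /eqP fS] := andP fP; have: y \in f @: setT by rewrite fS.
by case/imsetP => x _ ->; exists x.
Qed.

Lemma epiP (T G : finGroupType) (f g : epi T G) : f =1 g <-> f = g.
Proof. by split=> [fg|-> //]; apply/val_inj/ffunP. Qed.

Fact is_epi_intro (T G : finGroupType) (f : T -> G) :
    {morph f : x y / x * y} -> (forall y, exists x, f x = y) ->
  is_epi [ffun x => f x].
Proof.
move=> fM fS; apply/andP; split.
  by apply/morphicP => x y _ _; rewrite !ffunE.
apply/eqP/setP => y; rewrite inE; apply/imsetP.
by have [x <-] := fS y; exists x; rewrite ?ffunE.
Qed.

Definition mk_epi T G f fM fS := Epi (@is_epi_intro T G f fM fS).

Lemma mk_epiE T G f fM fS x : @mk_epi T G f fM fS x = f x.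
Proof. exact: ffunE. Qed.

Fact epi_id_surj (G : finGroupType) (y : G) : exists x : G, x = y.
Proof. by exists y. Qed.
Definition epi_id (G : finGroupType) : epi G G :=
  @mk_epi G G id (fun _ _ => erefl) (@epi_id_surj G).

Section Comp.
Variables (S T G : finGroupType) (g : epi T G) (f : epi S T).
Fact epi_compM : {morph g \o f : x y / x * y}.
Proof. by move=> x y; rewrite /= !epiM. Qed.
Fact epi_comp_surj y : exists x, (g \o f) x = y.
Proof.
by have [t <-] := epi_surj g y; have [s <-] := epi_surj f t; exists s.
Qed.
Definition epi_comp : epi S G := mk_epi epi_compM epi_comp_surj.
Lemma epi_compE x : epi_comp x = g (f x).
Proof. exact: mk_epiE. Qed.
End Comp.

(* Conjugation in the target; since f is surjective, conjugation in the source
   gives the same relation. *)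
Definition epi_conj (T G : finGroupType) : rel (epi T G) :=
  fun f g => [exists y, forall x, g x == f x ^ y].

Lemma epi_conjP T G (f g : epi T G) :
  reflect (exists y, forall x, g x = f x ^ y) (epi_conj f g).
Proof.
by apply: (iffP existsP) => -[y fg]; exists y;
  [move=> x; apply/eqP/(forallP fg) | apply/forallP => x; apply/eqP].
Qed.

Fact epi_conj_equiv T G : equiv_class_of (@epi_conj T G).
Proof.
have sym f g : epi_conj f g -> @epi_conj T G g f.
  move=> /epi_conjP[y fg]; apply/epi_conjP; exists y^-1 => x.
  by rewrite fg conjgK.
split=> [f|f g|g f h].
- by apply/epi_conjP; exists 1 => x; rewrite conjg1.
- by apply/idP/idP; apply: sym.
- move=> /epi_conjP[y fg] /epi_conjP[z gh]; apply/epi_conjP.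
  by exists (y * z) => x; rewrite gh fg conjgM.
Qed.
Canonical epi_conj_equiv_rel T G := EquivRelPack (@epi_conj_equiv T G).

(* The morphisms of the category of finite groups: conjugacy classes of
   surjective homomorphisms. *)
Definition outhom (T G : finGroupType) := {eq_quot @epi_conj T G}.
HB.instance Definition _ T G :=
  EqQuotient.on (outhom T G).
HB.instance Definition _ T G := Choice.on (outhom T G).
HB.instance Definition _ T G :=
  Finite.copy (outhom T G) (can_type (EquivQuot.ereprK
     (encD := defaultEncModRel (@epi_conj T G)))).

End Epi.

Section OuterCategory.
Implicit Types S T G H : finGroupType.

Definition outclass T G (f : epi T G) : outhom T G := \pi f.

Lemma outclassP T G (f g : epi T G) :
  reflect (outclass f = outclass g) (epi_conj f g).
Proof. exact: eqmodP. Qed.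

Lemma repr_outclass T G (f : epi T G) : epi_conj (repr (outclass f)) f.
Proof. by apply/outclassP; rewrite /outclass reprK. Qed.

Definition outid G : outhom G G := outclass (epi_id G).

Definition outcomp S T G (g : outhom T G) (f : outhom S T) : outhom S G :=
  outclass (epi_comp (repr g) (repr f)).

Lemma epi_comp_conj S T G (g g' : epi T G) (f f' : epi S T) :
  epi_conj g g' -> epi_conj f f' -> epi_conj (epi_comp g f) (epi_comp g' f').
Proof.
move=> /epi_conjP[y gy] /epi_conjP[z fz]; apply/epi_conjP.
by exists (g z * y)%g => x; rewrite !epi_compE gy fz epiJ conjgM.
Qed.

Lemma outcompE S T G (g : epi T G) (f : epi S T) :
  outcomp (outclass g) (outclass f) = outclass (epi_comp g f).
Proof. by apply/outclassP/epi_comp_conj; apply: repr_outclass. Qed.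

Lemma outhomP T G (f : outhom T G) : exists f0, f = outclass f0.
Proof. by exists (repr f); rewrite /outclass reprK. Qed.

Lemma outcompA S T G H (h : outhom G H) (g : outhom T G) (f : outhom S T) :
  outcomp h (outcomp g f) = outcomp (outcomp h g) f.
Proof.
have [h0 ->] := outhomP h; have [g0 ->] := outhomP g.
have [f0 ->] := outhomP f; rewrite !outcompE; congr outclass.
by apply/epiP => x; rewrite !epi_compE.
Qed.

Lemma outcomp1l T G (f : outhom T G) : outcomp (outid G) f = f.
Proof.
have [f0 ->] := outhomP f; rewrite !outcompE; congr outclass.
by apply/epiP => x; rewrite epi_compE mk_epiE.
Qed.

Lemma outcomp1r T G (f : outhom T G) : outcomp f (outid T) = f.
Proof.
have [f0 ->] := outhomP f; rewrite !outcompE; congr outclass.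
by apply/epiP => x; rewrite epi_compE mk_epiE.
Qed.

End OuterCategory.

(* A full replete subcategory of the category of finite groups and outer
   surjections is determined by its class of objects. *)
Record subcat := Subcat {
  in_subcat :> finGroupType -> Prop;
  subcat_replete : forall G H : finGroupType,
    [set: G] \isog [set: H] -> in_subcat G -> in_subcat H
}.

Record obj (U : subcat) := Obj {
  obj_group :> finGroupType;
  objP : U obj_group
}.

Definition widely_closed (U : subcat) :=
  forall (G H K : finGroupType) (f : epi H G) (g : epi H K)
         (W : {group (G * K)%type}),
    U G -> U H -> U K ->
    W = [set (f x, g x) | x : H] :> {set _} -> U (subg_of W).

Section Functors.
Variables (k : fieldType) (U : subcat).

(* Functors from the opposite of U to k-vector spaces. *)
Record rep := Rep {
  rep_ob :> obj U -> lmodType k;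
  rep_map : forall S T : obj U, outhom S T -> {linear rep_ob T -> rep_ob S};
  rep_map_id : forall T : obj U, rep_map (outid T) =1 id;
  rep_map_comp : forall (S T V : obj U) (g : outhom T V) (f : outhom S T),
    @rep_map S V (outcomp g f) =1 rep_map f \o rep_map g
}.

Record rep_hom (X Y : rep) := RepHom {
  rep_hom_fun :> forall T : obj U, {linear X T -> Y T};
  rep_hom_nat : forall (S T : obj U) (f : outhom S T),
    rep_hom_fun S \o rep_map X f =1 rep_map Y f \o rep_hom_fun T
}.

Definition isomorphic (X Y : rep) :=
  exists (f : rep_hom X Y) (g : rep_hom Y X),
    forall T : obj U, cancel (f T) (g T) /\ cancel (g T) (f T).

Definition epimorphism (X Y : rep) (p : rep_hom X Y) :=
  forall (Z : rep) (f g : rep_hom Y Z),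
    (forall T : obj U, f T \o p T =1 g T \o p T) ->
    forall T : obj U, f T =1 g T.

Definition projective (P : rep) :=
  forall (X Y : rep) (p : rep_hom X Y) (f : rep_hom P Y), epimorphism p ->
    exists g : rep_hom P X, forall T : obj U, p T \o g T =1 f T.

Section ZeroAndSum.

Definition rep0_map (S T : obj U) (_ : outhom S T) :
  {linear 'rV[k]_0 -> 'rV[k]_0} := \0.
Fact rep0_map_id (T : obj U) : rep0_map (outid T) =1 id.
Proof. by move=> x; rewrite /= [RHS]thinmx0. Qed.
Fact rep0_map_comp (S T V : obj U) (g : outhom T V) (f : outhom S T) :
  @rep0_map S V (outcomp g f) =1 rep0_map f \o rep0_map g.
Proof. by []. Qed.
Definition rep0 := @Rep (fun=> 'rV[k]_0) rep0_map rep0_map_id rep0_map_comp.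

Variables X Y : rep.

Definition sum_map_fun (S T : obj U) (f : outhom S T)
  (x : (X T * Y T)%type) : (X S * Y S)%type := (rep_map X f x.1, rep_map Y f x.2).
Fact sum_map_linear (S T : obj U) (f : outhom S T) : linear (sum_map_fun f).
Proof. by move=> a x y; rewrite /sum_map_fun !linearP. Qed.
HB.instance Definition _ (S T : obj U) (f : outhom S T) :=
  GRing.isLinear.Build k (X T * Y T)%type (X S * Y S)%type *:%R (sum_map_fun f)
    (sum_map_linear f).
Definition sum_map (S T : obj U) (f : outhom S T) :
  {linear (X T * Y T)%type -> (X S * Y S)%type} := sum_map_fun f.
Fact sum_map_id (T : obj U) : sum_map (outid T) =1 id.
Proof. by move=> [x y]; rewrite /= /sum_map_fun !rep_map_id. Qed.
Fact sum_map_comp (S T V : obj U) (g : outhom T V) (f : outhom S T) :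
  @sum_map S V (outcomp g f) =1 sum_map f \o sum_map g.
Proof. by move=> [x y]; rewrite /= /sum_map_fun !rep_map_comp. Qed.
Definition rep_sum :=
  @Rep (fun T => (X T * Y T)%type) sum_map sum_map_id sum_map_comp.

Definition tensor_map (S T : obj U) (f : outhom S T) :
  {linear tensor (X T) (Y T) -> tensor (X S) (Y S)} :=
  tens_map (rep_map X f) (rep_map Y f).
Fact tensor_map_id (T : obj U) : tensor_map (outid T) =1 id.
Proof.
by apply: (@tensor_ext k _ _ _ _ idfun) => v w /=; rewrite tens_mapE !rep_map_id.
Qed.
Fact tensor_map_comp (S T V : obj U) (g : outhom T V) (f : outhom S T) :
  @tensor_map S V (outcomp g f) =1 tensor_map f \o tensor_map g.
Proof.
apply: (@tensor_ext k _ _ _ _ (tensor_map f \o tensor_map g)) => v w /=.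
by rewrite !tens_mapE !rep_map_comp.
Qed.
Definition rep_tensor :=
  @Rep (fun T => tensor (X T) (Y T)) tensor_map tensor_map_id tensor_map_comp.

End ZeroAndSum.

Section Representable.
Variable G : obj U.

Definition rep_e_map (S T : obj U) (f : outhom S T) :
    {linear {ffun outhom T G -> k^o} -> {ffun outhom S G -> k^o}} :=
  free_push (fun g : outhom T G => outcomp g f).
Fact rep_e_map_id (T : obj U) : rep_e_map (outid T) =1 id.
Proof. by apply: free_push_id => g; apply: outcomp1r. Qed.
Fact rep_e_map_comp (S T V : obj U) (g : outhom T V) (f : outhom S T) :
  @rep_e_map S V (outcomp g f) =1 rep_e_map f \o rep_e_map g.
Proof. by apply: free_push_comp => h; apply: outcompA. Qed.
Definition rep_e := @Rep (fun T => {ffun outhom T G -> k^o}) rep_e_map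
  rep_e_map_id rep_e_map_comp.

End Representable.

(* The direct sum of the rep_e G, for G in the list Gs, is a foldr. *)
Definition finitely_generated (X : rep) :=
  exists (Gs : seq (obj U))
         (p : rep_hom (foldr (fun G Y => rep_sum (rep_e G) Y) rep0 Gs) X),
    epimorphism p.

End Functors.

Section PermutedFamily.
Variable U : subcat.
Local Open Scope group_scope.

(* Gamma acts on the left. The star maps are dependently typed, so their
   functoriality is an equality of elements of the sum of the groups. *)
Record permuted_family := PermutedFamily {
  pf_group : finGroupType;
  pf_set : finType;
  pf_act : pf_group -> pf_set -> pf_set;
  pf_fam : pf_set -> obj U;
  pf_star : forall (c : pf_group) (a : pf_set),
    epi (pf_fam a) (pf_fam (pf_act c a));
  pf_act1 : forall a, pf_act 1 a = a;
  pf_actM : forall d c a, pf_act (d * c) a = pf_act d (pf_act c a);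
  pf_star_inj : forall c a, injective (pf_star c a);
  pf_star1 : forall a x, Tagged pf_fam (pf_star 1 a x) = Tagged pf_fam x;
  pf_starM : forall d c a x, Tagged pf_fam (pf_star (d * c) a x) =
    Tagged pf_fam (pf_star d (pf_act c a) (pf_star c a x))
}.

(* The equation in the sum of the groups says that c acts on fam a, after
   identifying fam (pf_act c a) with fam a, as conjugation by y. *)
Definition outer (P : permuted_family) :=
  forall (a : pf_set P) (y : pf_fam a), exists2 c : pf_group P, pf_act c a = a &
    forall x, Tagged (@pf_fam P) (pf_star c a x) = Tagged (@pf_fam P) (x ^ y).

Record outer_family := OuterFamily {
  of_family :> permuted_family;
  of_outer : outer of_family
}.

Section Btilde.
Variable P : permuted_family.
Local Notation fam := (@pf_fam P).

Definition Btilde (T : finGroupType) := {a : pf_set P & epi T (fam a)}.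

Lemma Btilde_eq T a b (f : epi T (fam a)) (g : epi T (fam b)) :
  (forall t, Tagged fam (f t) = Tagged fam (g t)) ->
  Tagged (fun a => epi T (fam a)) f = Tagged (fun a => epi T (fam a)) g.
Proof.
move=> fg; have ab : a = b := congr1 tag (fg 1).
move: f g fg; rewrite ab => f g fg; congr Tagged.
by apply/epiP => t; apply: eq_from_Tagged (fg t).
Qed.

Definition Btilde_act T (c : pf_group P) (x : Btilde T) : Btilde T :=
  Tagged (fun a => epi T (fam a)) (epi_comp (pf_star c (tag x)) (tagged x)).

Lemma Btilde_act1 T (x : Btilde T) : Btilde_act 1 x = x.
Proof.
by case: x => a f; apply: Btilde_eq => t; rewrite epi_compE pf_star1.
Qed.

Lemma Btilde_actM T d c (x : Btilde T) :
  Btilde_act (d * c) x = Btilde_act d (Btilde_act c x).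
Proof.
by case: x => a f; apply: Btilde_eq => t; rewrite !epi_compE pf_starM.
Qed.

Definition Btilde_rel T : rel (Btilde T) :=
  fun x y => [exists c, y == Btilde_act c x].

Fact Btilde_rel_equiv T : equiv_class_of (@Btilde_rel T).
Proof.
have sym x y : Btilde_rel x y -> @Btilde_rel T y x.
  move=> /existsP[c /eqP ->]; apply/existsP; exists c^-1.
  by rewrite -Btilde_actM mulVg Btilde_act1.
split=> [x|x y|y x z].
- by apply/existsP; exists 1; rewrite Btilde_act1.
- by apply/idP/idP; apply: sym.
- move=> /existsP[c /eqP ->] /existsP[d /eqP ->]; apply/existsP.
  by exists (d * c); rewrite Btilde_actM.
Qed.
Canonical Btilde_equiv_rel T := EquivRelPack (@Btilde_rel_equiv T).

Definition Borb (T : finGroupType) := {eq_quot @Btilde_rel T}.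
HB.instance Definition _ T := EqQuotient.on (Borb T).
HB.instance Definition _ T := Choice.on (Borb T).
HB.instance Definition _ T := Finite.copy (Borb T)
  (can_type (EquivQuot.ereprK (encD := defaultEncModRel (@Btilde_rel T)))).

Definition Bclass T (x : Btilde T) : Borb T := \pi x.

Lemma BclassP T (x y : Btilde T) :
  reflect (Bclass x = Bclass y) (Btilde_rel x y).
Proof. exact: eqmodP. Qed.

Lemma BorbP T (q : Borb T) : exists x, q = Bclass x.
Proof. by exists (repr q); rewrite /Bclass reprK. Qed.

Definition Btilde_map S T (f : epi S T) (x : Btilde T) : Btilde S :=
  Tagged (fun a => epi S (fam a)) (epi_comp (tagged x) f).

Lemma Btilde_map_act S T (f : epi S T) c (x : Btilde T) :
  Btilde_map f (Btilde_act c x) = Btilde_act c (Btilde_map f x).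
Proof. by case: x => a g; apply: Btilde_eq => t; rewrite !epi_compE. Qed.

Definition Borb_map S T (f : outhom S T) (q : Borb T) : Borb S :=
  Bclass (Btilde_map (repr f) (repr q)).

Hypothesis oP : outer P.

Lemma Btilde_map_conj S T (f g : epi S T) (x : Btilde T) :
  epi_conj f g -> Btilde_rel (Btilde_map f x) (Btilde_map g x).
Proof.
case: x => a h /epi_conjP[y fg]; have [c _ cy] := oP (h y).
apply/existsP; exists c; apply/eqP; apply: Btilde_eq => t.
by rewrite !epi_compE cy fg epiJ.
Qed.

Lemma Borb_mapE S T (f : epi S T) (x : Btilde T) :
  Borb_map (outclass f) (Bclass x) = Bclass (Btilde_map f x).
Proof.
have /BclassP/existsP[c /eqP xc] : Bclass (repr (Bclass x)) = Bclass x.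
  by rewrite /Bclass reprK.
apply: (etrans (y := Bclass (Btilde_map f (repr (Bclass x))))).
  exact/BclassP/Btilde_map_conj/repr_outclass.
by apply/BclassP/existsP; exists c; rewrite {1}xc Btilde_map_act.
Qed.

Lemma Borb_map_id T (q : Borb T) : Borb_map (outid T) q = q.
Proof.
have [[a f] ->] := BorbP q; rewrite Borb_mapE; congr Bclass.
by apply: Btilde_eq => t; rewrite epi_compE mk_epiE.
Qed.

Lemma Borb_map_comp S T V (g : outhom T V) (f : outhom S T) (q : Borb V) :
  Borb_map (outcomp g f) q = Borb_map f (Borb_map g q).
Proof.
have [x ->] := BorbP q; have [g0 ->] := outhomP g; have [f0 ->] := outhomP f.
rewrite outcompE !Borb_mapE; congr Bclass; case: x => a h.
by apply: Btilde_eq => t; rewrite !epi_compE.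
Qed.

End Btilde.

End PermutedFamily.

Section FunctorF.
Variables (k : fieldType) (U : subcat) (P : outer_family U).

Definition rep_F_map (S T : obj U) (f : outhom S T) :
    {linear {ffun Borb P T -> k^o} -> {ffun Borb P S -> k^o}} :=
  free_push (@Borb_map U P S T f).
Fact rep_F_map_id (T : obj U) : rep_F_map (outid T) =1 id.
Proof. by apply: free_push_id => q; apply/Borb_map_id/of_outer. Qed.
Fact rep_F_map_comp (S T V : obj U) (g : outhom T V) (f : outhom S T) :
  @rep_F_map S V (outcomp g f) =1 rep_F_map f \o rep_F_map g.
Proof. by apply: free_push_comp => q; apply/Borb_map_comp/of_outer. Qed.
Definition rep_F := @Rep k U (fun T => {ffun Borb P T -> k^o}) rep_F_map
  rep_F_map_id rep_F_map_comp.

End FunctorF.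

Section WideFamily.
Variables (U : subcat) (G H : obj U).
Local Open Scope group_scope.

Definition wide (W : {set G * H}) :=
  ([set w.1 | w in W] == [set: G]) && ([set w.2 | w in W] == [set: H]).

Definition Wide :=
  {W : {group (G * H)%type} | wide W && `[< U (subg_of W) >]}.

Implicit Types (c d : (G * H)%type) (W : Wide).

Definition wide_obj W : obj U := Obj (asboolW (andP (valP W)).2).

Section Conj.
Variables (c : (G * H)%type) (W : {group (G * H)%type}).

Definition wide_conj_fun (x : subg_of W) : subg_of (W :^ c^-1)%G :=
  subg (W :^ c^-1)%G (c * sgval x * c^-1).

Lemma wide_conj_funE x : sgval (wide_conj_fun x) = c * sgval x * c^-1.
Proof.
rewrite subgK // mem_conjg invgK conjgE !mulgA mulVg mul1g.
by rewrite mulgKV subgP.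
Qed.

Fact wide_conj_funM : {morph wide_conj_fun : x y / x * y}.
Proof.
by move=> x y; apply/val_inj; rewrite /= !wide_conj_funE !mulgA mulgKV.
Qed.

Fact wide_conj_fun_inj : injective wide_conj_fun.
Proof.
move=> x y /(congr1 sgval); rewrite !wide_conj_funE => /mulIg/mulgI.
exact: val_inj.
Qed.

Fact wide_conj_fun_surj y : exists x, wide_conj_fun x = y.
Proof.
have yW : sgval y ^ c \in W by have := subgP y; rewrite mem_conjg invgK.
exists (subg W (sgval y ^ c)); apply/val_inj; rewrite /= wide_conj_funE.
by rewrite subgK // conjgE !mulgA mulgV mul1g mulgK.
Qed.

Definition wide_conj : epi (subg_of W) (subg_of (W :^ c^-1)%G) :=
  mk_epi wide_conj_funM wide_conj_fun_surj.

Lemma wide_conjE x : sgval (wide_conj x) = c * sgval x * c^-1.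
Proof. by rewrite mk_epiE wide_conj_funE. Qed.

Lemma wide_conj_inj : injective wide_conj.
Proof. by move=> x y; rewrite !mk_epiE => /wide_conj_fun_inj. Qed.

Lemma wide_conj_isog :
  [set: subg_of W] \isog [set: subg_of (W :^ c^-1)%G].
Proof.
have fM : {in [set: subg_of W] &, {morph wide_conj_fun : x y / x * y}}.
  by move=> x y _ _; apply: wide_conj_funM.
apply/isogP; exists (Morphism fM).
  by apply/injmP => x y _ _; apply: wide_conj_fun_inj.
apply/setP => y; rewrite inE; apply/morphimP.
by have [x <-] := wide_conj_fun_surj y; exists x; rewrite ?inE.
Qed.

End Conj.

Fact wide_act_subproof c W :
  wide (val W :^ c^-1)%G && `[< U (subg_of (val W :^ c^-1)%G) >].
Proof.
case: W => W /= /andP[/andP[/eqP W1 /eqP W2] /asboolP UW].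
apply/andP; split; last exact/asboolP/(subcat_replete (wide_conj_isog c W)).
apply/andP; split; apply/eqP/setP => y; rewrite !inE; apply/imsetP.
  have /imsetP[w wW yw] : y ^ c.1 \in [set w.1 | w in W] by rewrite W1 inE.
  exists (w ^ c^-1); first by rewrite memJ_conjg.
  by rewrite -[LHS](conjgK c.1) yw.
have /imsetP[w wW yw] : y ^ c.2 \in [set w.2 | w in W] by rewrite W2 inE.
exists (w ^ c^-1); first by rewrite memJ_conjg.
by rewrite -[LHS](conjgK c.2) yw.
Qed.

(* Left conjugation: c W c^-1 is W :^ c^-1, as x ^ y = y^-1 * x * y. *)
Definition wide_act c W : Wide :=
  exist (fun V : {group (G * H)%type} => is_true (wide V && `[< U (subg_of V) >]))
    (val W :^ c^-1)%G (wide_act_subproof c W).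

Definition wide_star c W : epi (wide_obj W) (wide_obj (wide_act c W)) :=
  wide_conj c (val W).

Lemma wide_Tagged (W W' : Wide) (x : wide_obj W) (y : wide_obj W') :
  W = W' -> sgval x = sgval y -> Tagged wide_obj x = Tagged wide_obj y.
Proof.
move=> WW'; move: x y; rewrite WW' => x y xy; congr Tagged; exact: val_inj.
Qed.

Fact wide_act1 W : wide_act 1 W = W.
Proof. by apply/val_inj/val_inj; rewrite /= invg1 conjsg1. Qed.
Fact wide_actM d c W : wide_act (d * c) W = wide_act d (wide_act c W).
Proof. by apply/val_inj/val_inj; rewrite /= invMg conjsgM. Qed.
Fact wide_star_inj c W : injective (wide_star c W).
Proof. exact: wide_conj_inj. Qed.
Fact wide_star1 W x :
  Tagged wide_obj (wide_star 1 W x) = Tagged wide_obj x.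
Proof.
apply: wide_Tagged (wide_act1 W) _.
by rewrite wide_conjE invg1 mulg1 mul1g.
Qed.
Fact wide_starM d c W x : Tagged wide_obj (wide_star (d * c) W x) =
  Tagged wide_obj (wide_star d (wide_act c W) (wide_star c W x)).
Proof.
apply: wide_Tagged (wide_actM d c W) _.
by rewrite !wide_conjE invMg !mulgA.
Qed.

Definition wide_permuted : permuted_family U :=
  PermutedFamily wide_act1 wide_actM wide_star_inj wide_star1 wide_starM.

Fact wide_outer : outer wide_permuted.
Proof.
move=> W y; have e : wide_act (sgval y)^-1 W = W.
  by apply/val_inj/val_inj; rewrite /= invgK conjGid ?subgP.
exists (sgval y)^-1 => // x; apply: wide_Tagged e _.
by rewrite wide_conjE invgK -mulgA.
Qed.

Definition wide_family : outer_family U := OuterFamily wide_outer.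

End WideFamily.

(* Main.v *)
From HB Require Import structures.
Require Import Defs.
From mathcomp Require Import all_boot all_order all_algebra all_fingroup.
From mathcomp Require Import generic_quotient boolp.

Set Implicit Arguments.
Unset Strict Implicit.
Unset Printing Implicit Defensive.

Import GRing.Theory.

Local Open Scope ring_scope.

(** A pair of surjections [T -> G] and [T -> H] is the same thing as a
    surjection from [T] onto a wide subgroup [W] of [G * H], namely the image
    of the combined homomorphism; as [U] is widely closed, [W] belongs to [U].
    Conjugating the two surjections independently amounts to letting
    [Gamma = G * H] act by conjugation on [W] and on the surjection. Hence
    [outhom T G * outhom T H] is in natural bijection with the orbit set
    [Borb (wide_family G H) T] ([Borb_pair_bij], [Borb_pair_map]). A tensor
    product of free modules being free on the product of the bases, this gives
    the isomorphism between [e_G] tensor [e_H] and [F(W(G, H))].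

    The other two claims hold for [F = rep_F k P] with [P] any outer permuted
    family. A map from [F] to [X] is determined by the images [x_a] in
    [X (G_a)] of the tautological elements [(a, 1)], and it exists as soon as
    [(x_a)] is invariant under [Gamma]. So these finitely many elements
    generate [F], which is a quotient of the direct sum of the [e_{G_a}]
    ([rep_F_finitely_generated]). To lift a map [F -> Y] along an
    epimorphism [X -> Y], choose preimages in [X (G_a)] of the images of the
    tautological elements, which is possible since epimorphisms are pointwise
    surjective ([epimorphism_surj]), and average them over [Gamma] to make them
    invariant; the average is still a preimage, because the elements of [Y]
    were invariant already. This divides by the order of [Gamma] and so uses
    characteristic zero ([rep_F_projective]). *)

(** * Linear maps out of free modules *)

Section FreeLift.
Variables (k : fieldType) (S : finType).

Definition free_basis (s : S) : {ffun S -> k^o} := [ffun t => (t == s)%:R].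

Lemma free_basis_sum (x : {ffun S -> k^o}) : x = \sum_s x s *: free_basis s.
Proof.
apply/ffunP => t; rewrite sum_ffunE (bigD1 t) //= big1 => [|s st].
  by rewrite addr0 !ffunE eqxx /= [RHS]mulr1.
by rewrite !ffunE eq_sym (negPf st) /= [LHS]mulr0.
Qed.

Variable M : lmodType k.

Lemma free_ext (f g : {linear {ffun S -> k^o} -> M}) :
  (forall s, f (free_basis s) = g (free_basis s)) -> f =1 g.
Proof.
move=> fg x; rewrite (free_basis_sum x) !linear_sum; apply: eq_bigr => s _.
by rewrite !linearZ /= fg.
Qed.

Variable h : S -> M.

Definition free_lift (x : {ffun S -> k^o}) : M := \sum_s x s *: h s.

Fact free_lift_linear : linear free_lift.
Proof.
move=> a x y; rewrite /free_lift scaler_sumr -big_split.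
by apply: eq_bigr => s _; rewrite !ffunE scalerDl scalerA.
Qed.
HB.instance Definition _ := GRing.isLinear.Build k {ffun S -> k^o} M *:%R
  free_lift free_lift_linear.

Lemma free_lift_basis s : free_lift (free_basis s) = h s.
Proof.
rewrite /free_lift (bigD1 s) //= big1 => [|t ts].
  by rewrite addr0 ffunE eqxx scale1r.
by rewrite ffunE (negPf ts) scale0r.
Qed.

End FreeLift.

Lemma free_push_basis (k : fieldType) (S S' : finType) (f : S -> S') s :
  free_push f (free_basis k s) = free_basis k (f s).
Proof.
apply/ffunP => t; rewrite !ffunE.
have [->|ts] := eqVneq t (f s).
  rewrite (bigD1 s) //= big1 => [|u /andP[_ us]]; first by rewrite ffunE eqxx addr0.
  by rewrite ffunE (negPf us).
rewrite big1 // => u /eqP fu; rewrite ffunE; case: eqVneq => // us.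
by rewrite -fu us eqxx in ts.
Qed.

(** * Epimorphisms and isomorphisms of functors *)

(** The cokernel of a natural transformation is formed pointwise. Comparing the
    projection onto it with the zero map turns the cancellation property that
    defines epimorphisms into pointwise surjectivity. *)
Section Cokernel.
Variables (k : fieldType) (U : subcat) (X Y : rep k U) (p : rep_hom X Y).

Definition rep_image_pred (T : obj U) : {pred Y T} := fun y => `[< exists x, p T x = y >].

Fact rep_image_pred_closed (T : obj U) : submod_closed (@rep_image_pred T).
Proof.
split=> [|a y z]; rewrite !unfold_in.
  by apply/asboolP; exists 0; rewrite linear0.
move=> /asboolP[v <-] /asboolP[w <-]; apply/asboolP.
by exists (a *: v + w); rewrite linearP.
Qed.

Definition rep_image (T : obj U) := Submodule (@rep_image_pred_closed T).

Lemma rep_map_image (S T : obj U) (f : outhom S T) (y : Y T) :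
  y \in rep_image T -> rep_map Y f y \in rep_image S.
Proof.
rewrite !unfold_in => /asboolP[x <-]; apply/asboolP.
by exists (rep_map X f x); rewrite [LHS](rep_hom_nat p f x).
Qed.

Definition coker_fun (S T : obj U) (f : outhom S T) (x : quot_mod (rep_image T)) :
  quot_mod (rep_image S) := quot_pi (rep_image S) (rep_map Y f (repr x)).

Lemma coker_funE (S T : obj U) (f : outhom S T) (y : Y T) :
  coker_fun f (quot_pi (rep_image T) y) = quot_pi (rep_image S) (rep_map Y f y).
Proof.
apply/quot_piP; rewrite -linearB; apply/rep_map_image/quot_piP.
by rewrite quot_piK.
Qed.

Fact coker_fun_linear (S T : obj U) (f : outhom S T) : linear (coker_fun f).
Proof.
move=> a x y; rewrite -[x]quot_piK -[y]quot_piK -linearP !coker_funE.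
by rewrite !linearP.
Qed.
HB.instance Definition _ (S T : obj U) (f : outhom S T) :=
  GRing.isLinear.Build k (quot_mod (rep_image T)) (quot_mod (rep_image S)) *:%R
    (coker_fun f) (coker_fun_linear f).

Definition coker_map (S T : obj U) (f : outhom S T) :
  {linear quot_mod (rep_image T) -> quot_mod (rep_image S)} := coker_fun f.

Fact coker_map_id (T : obj U) : coker_map (outid T) =1 id.
Proof. by move=> x; rewrite -[x]quot_piK /= coker_funE rep_map_id. Qed.

Fact coker_map_comp (S T V : obj U) (g : outhom T V) (f : outhom S T) :
  @coker_map S V (outcomp g f) =1 coker_map f \o coker_map g.
Proof. by move=> x; rewrite -[x]quot_piK /= !coker_funE rep_map_comp. Qed.

Definition coker := @Rep k U (fun T => quot_mod (rep_image T)) coker_map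
  coker_map_id coker_map_comp.

Definition coker_pi : rep_hom Y coker :=
  @RepHom k U Y coker (fun T => quot_pi (rep_image T))
    (fun S T f y => esym (coker_funE f y)).

Definition coker_zero : rep_hom Y coker :=
  @RepHom k U Y coker (fun T => \0)
    (fun S T f y => esym (linear0 (rep_map coker f))).

Lemma epimorphism_surj : epimorphism p -> forall T y, exists x, p T x = y.
Proof.
move=> /(_ coker coker_pi coker_zero) pE T y.
have pi0 S : coker_pi S \o p S =1 coker_zero S \o p S.
  move=> x; rewrite /= -[RHS](linear0 (quot_pi (rep_image S))); apply/quot_piP.
  by rewrite subr0 unfold_in; apply/asboolP; exists x.
have := pE pi0 T y; rewrite /= -(linear0 (quot_pi (rep_image T))) => /quot_piP.
by rewrite subr0 unfold_in => /asboolP.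
Qed.

End Cokernel.

Section RepHom.
Variables (k : fieldType) (U : subcat).
Implicit Types X Y Z : rep k U.

Fact rep_comp_nat X Y Z (g : rep_hom Y Z) (f : rep_hom X Y) (S T : obj U)
    (u : outhom S T) :
  (g S \o f S) \o rep_map X u =1 rep_map Z u \o (g T \o f T).
Proof.
by move=> x; have /= -> := rep_hom_nat f u x; apply: (rep_hom_nat g).
Qed.

Definition rep_comp X Y Z (g : rep_hom Y Z) (f : rep_hom X Y) : rep_hom X Z :=
  @RepHom k U X Z (fun T => g T \o f T) (rep_comp_nat g f).

Lemma isomorphic_intro X Y (f : rep_hom X Y)
    (g : forall T : obj U, {linear Y T -> X T}) :
  (forall T, cancel (f T) (g T)) -> (forall T, cancel (g T) (f T)) ->
  isomorphic Y X.
Proof.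
move=> fK gK.
have g_nat (S T : obj U) (u : outhom S T) : g S \o rep_map Y u =1 rep_map X u \o g T.
  move=> y; apply: (can_inj (fK S)); rewrite /= gK.
  by have /= -> := rep_hom_nat f u (g T y); rewrite gK.
by exists (RepHom g_nat), f => T; split.
Qed.

Lemma finitely_generated_iso X Y :
  isomorphic X Y -> finitely_generated Y -> finitely_generated X.
Proof.
move=> [f [g fgK]] [Gs [p pE]]; exists Gs, (rep_comp g p) => Z u v uv T x.
rewrite -((fgK T).1 x); apply: (pE Z (rep_comp u g) (rep_comp v g)) => S y.
exact: uv.
Qed.

Lemma projective_iso X Y : isomorphic X Y -> projective Y -> projective X.
Proof.
move=> [f [g fgK]] Yproj V W p h pE.
have [l lE] := Yproj V W p (rep_comp h g) pE.
by exists (rep_comp l f) => T x; rewrite /= [LHS]lE /= (fgK T).1.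
Qed.

Lemma yoneda X (G : obj U) (x : X G) :
  exists p : rep_hom (rep_e k G) X,
    forall (T : obj U) (u : outhom T G), p T (free_basis k u) = rep_map X u x.
Proof.
pose p (T : obj U) : {linear {ffun outhom T G -> k^o} -> X T} :=
  free_lift (fun u => rep_map X u x).
have p_nat (S T : obj U) (u : outhom S T) :
    p S \o rep_map (rep_e k G) u =1 rep_map X u \o p T.
  apply: (@free_ext _ _ _ (p S \o rep_map (rep_e k G) u) (rep_map X u \o p T)).
  move=> v /=; rewrite free_push_basis !free_lift_basis.
  exact: rep_map_comp.
by exists (@RepHom k U (rep_e k G) X p p_nat) => T u; rewrite /= free_lift_basis.
Qed.

(** Summing Yoneda maps: a family of elements [x i] defines a map to [X] from
    the direct sum of the representables, whose image contains every translate
    of every [x i]. It is stated for a sequence [s] of indices so as to follow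
    the recursive construction of the direct sum. *)
Lemma sum_cover X (I : eqType) (fam : I -> obj U) (x : forall i, X (fam i))
    (s : seq I) :
  exists p : rep_hom (foldr (fun G Y => rep_sum (rep_e k G) Y) (rep0 k U) (map fam s)) X,
    forall (T : obj U) i (u : outhom T (fam i)), i \in s ->
      exists v, p T v = rep_map X u (x i).
Proof.
elim: s => [|i s [p pE]] /=.
  by exists (@RepHom k U (rep0 k U) X (fun T => \0)
    (fun S T f y => esym (linear0 (rep_map X f)))).
set Z := foldr _ _ _ in p pE *; have [q qE] := yoneda (x i).
pose r_fun (T : obj U) (z : rep_sum (rep_e k (fam i)) Z T) : X T :=
  q T z.1 + p T z.2.
have r_lin (T : obj U) : linear (@r_fun T).
  by move=> a y z; rewrite /r_fun !linearP scalerDr addrACA.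
pose r (T : obj U) : {linear rep_sum (rep_e k (fam i)) Z T -> X T} :=
  HB.pack (@r_fun T) (GRing.isLinear.Build _ _ _ _ _ (r_lin T)).
have r_nat (S T : obj U) (u : outhom S T) :
    r S \o rep_map (rep_sum (rep_e k (fam i)) Z) u =1 rep_map X u \o r T.
  move=> [y z]; rewrite /= /r_fun /= linearD /=; congr (_ + _).
    exact: (rep_hom_nat q u y).
  exact: (rep_hom_nat p u z).
exists (@RepHom k U (rep_sum (rep_e k (fam i)) Z) X r r_nat) => T j u /=.
rewrite inE; have [ji _|_ /= js] := eqVneq j i.
  subst j; exists (free_basis k u, 0).
  by rewrite /= /r_fun /= linear0 addr0 qE.
have [v vE] := pE T j u js; exists (0, v).
by rewrite /= /r_fun /= linear0 add0r.
Qed.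

End RepHom.

(** * Functors of outer permuted families *)

Section FamilyFunctor.
Variables (k : fieldType) (U : subcat) (P : outer_family U).
Local Notation F := (rep_F k P).

Definition Btaut (a : pf_set P) : Btilde P (pf_fam a) :=
  Tagged (fun a => epi (pf_fam _) (pf_fam a)) (epi_id (pf_fam a)).

(** The tautological elements generate: [(a, alpha)] is the translate of
    [(a, 1)] along [alpha]. *)
Lemma Btilde_map_taut (T : obj U) (x : Btilde P T) :
  Btilde_map (tagged x) (Btaut (tag x)) = x.
Proof.
by case: x => a f; apply: Btilde_eq => t; rewrite epi_compE mk_epiE.
Qed.

Lemma rep_F_map_basis (S T : obj U) (f : epi S T) (x : Btilde P T) :
  rep_map F (outclass f) (free_basis k (Bclass x)) =
  free_basis k (Bclass (Btilde_map f x)).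
Proof. by rewrite /= free_push_basis Borb_mapE //; apply: of_outer. Qed.

Lemma rep_F_finitely_generated : finitely_generated F.
Proof.
have [p pE] := sum_cover (fun a => free_basis k (Bclass (Btaut a)) : F (pf_fam a))
  (enum (pf_set P)).
eexists _, p => Z f g fg T; apply: free_ext => q; have [x ->] := BorbP q.
rewrite -(Btilde_map_taut x) -rep_F_map_basis.
have [v <-] := pE T (tag x) (outclass (tagged x)) (mem_enum _ _).
exact: fg.
Qed.

(** A family of elements [x a] of [X (G_a)] sends [(a, alpha)] to
    [alpha^* (x a)] in [X T]; taking the mean over the [Gamma]-orbit makes this
    constant on orbits, hence a map out of [F]. Working with elements of
    [Btilde] rather than with [x] keeps the action laws equations in one type,
    whereas [x (d c a)] and [x (d (c a))] live in different modules. *)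
Section Average.
Variables (X : rep k U) (x : forall a : pf_set P, X (pf_fam a)).

Definition Bval (T : obj U) (b : Btilde P T) : X T :=
  rep_map X (outclass (tagged b)) (x (tag b)).

Lemma Bval_map (S T : obj U) (f : epi S T) (b : Btilde P T) :
  Bval (Btilde_map f b) = rep_map X (outclass f) (Bval b).
Proof. by rewrite /Bval /= -outcompE rep_map_comp. Qed.

(** The sum runs over [Gamma], not over the orbit: each point of the orbit is
    counted as often as its stabiliser has elements. *)
Definition Baverage (T : obj U) (b : Btilde P T) : X T :=
  (#|pf_group P|%:R)^-1 *: \sum_(c : pf_group P) Bval (Btilde_act c b).

Lemma Baverage_rel (T : obj U) (b b' : Btilde P T) :
  Btilde_rel b b' -> Baverage b = Baverage b'.
Proof.
move=> /existsP[d /eqP ->]; congr (_ *: _).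
rewrite [LHS](reindex_inj (mulIg d)) /=; apply: eq_bigr => c _.
by rewrite Btilde_actM.
Qed.

Lemma Baverage_map (S T : obj U) (f : epi S T) (b : Btilde P T) :
  Baverage (Btilde_map f b) = rep_map X (outclass f) (Baverage b).
Proof.
rewrite /Baverage [RHS]linearZ /=; congr (_ *: _).
rewrite [RHS]linear_sum; apply: eq_bigr => c _.
by rewrite -Btilde_map_act Bval_map.
Qed.

Definition average_fun (T : obj U) : {linear F T -> X T} :=
  free_lift (fun q : Borb P T => Baverage (repr q)).

Lemma average_fun_basis (T : obj U) (b : Btilde P T) :
  average_fun T (free_basis k (Bclass b)) = Baverage b.
Proof.
rewrite /= free_lift_basis; apply/Baverage_rel/BclassP.
by rewrite /Bclass reprK.
Qed.

Fact average_nat (S T : obj U) (f : outhom S T) :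
  average_fun S \o rep_map F f =1 rep_map X f \o average_fun T.
Proof.
apply: (@free_ext _ _ _ (average_fun S \o rep_map F f)
  (rep_map X f \o average_fun T)) => q.
have [b ->] := BorbP q; have [f0 ->] := outhomP f.
rewrite [LHS](congr1 (average_fun S) (rep_F_map_basis f0 b)) [RHS]/=.
by rewrite !average_fun_basis Baverage_map.
Qed.

Definition average : rep_hom F X := RepHom average_nat.

End Average.

Hypothesis k_char0 : [pchar k] =i pred0.

Lemma rep_F_projective : projective F.
Proof.
move=> X Y p f /epimorphism_surj p_surj.
pose y (a : pf_set P) := f (pf_fam a) (free_basis k (Bclass (Btaut a))).
have /(_ _)/cid-/all_sig[x xE] a : exists v, p (pf_fam a) v = y a.
  exact: p_surj.
have pBval (T : obj U) (b : Btilde P T) :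
    p T (Bval x b) = f T (free_basis k (Bclass b)).
  have /esym bE := Btilde_map_taut b.
  rewrite [RHS](congr1 (fun c => f T (free_basis k (Bclass c))) bE).
  rewrite -rep_F_map_basis [LHS](rep_hom_nat p) /= xE.
  by rewrite [RHS](rep_hom_nat f).
exists (average x) => T.
apply: (@free_ext _ _ _ (p T \o average x T) (f T)) => q.
have [b ->] := BorbP q; rewrite [LHS](congr1 (p T) (average_fun_basis x b)).
rewrite linearZ linear_sum /=.
(* Under [p] every summand becomes the value of [f] at the orbit of [b], so the
   mean over the group is that value. *)
under eq_bigr => c _.
  rewrite pBval (_ : Bclass (Btilde_act c b) = Bclass b); last first.
    by apply/esym/BclassP/existsP; exists c.
  over.
rewrite sumr_const -scaler_nat scalerA mulVf ?scale1r //.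
rewrite (pcharf0P k).1 // -lt0n; apply/card_gt0P.
by exists 1%g.
Qed.

End FamilyFunctor.

(** * Wide subgroups and pairs of outer surjections *)

Section WidePairs.
Variables (U : subcat) (G H : obj U).
Local Open Scope group_scope.
Local Notation P := (wide_family G H).

Section Projections.
Variable W : Wide G H.

Let W1 : [set w.1 | w in val W] = [set: G].
Proof. by case/andP: (valP W) => /andP[/eqP]. Qed.
Let W2 : [set w.2 | w in val W] = [set: H].
Proof. by case/andP: (valP W) => /andP[_ /eqP]. Qed.

Fact wide_fst_surj y : exists x : wide_obj W, (sgval x).1 = y.
Proof.
have /imsetP[w wW ->] : y \in [set w.1 | w in val W] by rewrite W1 inE.
by exists (subg (val W) w); rewrite subgK.
Qed.
Fact wide_snd_surj y : exists x : wide_obj W, (sgval x).2 = y.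
Proof.
have /imsetP[w wW ->] : y \in [set w.2 | w in val W] by rewrite W2 inE.
by exists (subg (val W) w); rewrite subgK.
Qed.

Definition wide_fst : epi (wide_obj W) G :=
  @mk_epi (wide_obj W) G (fun x => (sgval x).1) (fun _ _ => erefl) wide_fst_surj.
Definition wide_snd : epi (wide_obj W) H :=
  @mk_epi (wide_obj W) H (fun x => (sgval x).2) (fun _ _ => erefl) wide_snd_surj.

End Projections.

Section Pairs.
Variable T : obj U.
Implicit Type b : Btilde P T.

Definition Bfst b : epi T G := epi_comp (wide_fst (tag b)) (tagged b).
Definition Bsnd b : epi T H := epi_comp (wide_snd (tag b)) (tagged b).

Lemma BfstE b t : Bfst b t = (sgval (tagged b t)).1.
Proof. by rewrite epi_compE mk_epiE. Qed.
Lemma BsndE b t : Bsnd b t = (sgval (tagged b t)).2.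
Proof. by rewrite epi_compE mk_epiE. Qed.

Definition Bpair b : outhom T G * outhom T H :=
  (outclass (Bfst b), outclass (Bsnd b)).

(** The subgroup is recovered as the image of the surjection onto it, so an
    element of [Btilde] is determined by its two components. *)
Lemma wide_Btilde_eq b b' : Bfst b =1 Bfst b' -> Bsnd b =1 Bsnd b' -> b = b'.
Proof.
case: b => V f; case: b' => W g fg1 fg2.
have fg t : sgval (f t) = sgval (g t).
  rewrite [LHS]surjective_pairing [RHS]surjective_pairing.
  by have := fg1 t; have := fg2 t; rewrite !BfstE !BsndE /= => -> ->.
have VW : V = W.
  apply/val_inj/group_inj/setP => w; apply/idP/idP => wX.
    have [t ft] := epi_surj f (subg (val V) w).
    by have := fg t; rewrite ft subgK // => ->; apply: subgP.
  have [t gt] := epi_surj g (subg (val W) w).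
  by have := fg t; rewrite gt subgK // => <-; apply: subgP.
by apply: Btilde_eq => t; apply: wide_Tagged.
Qed.

Lemma wide_Btilde_actE c b t :
  sgval (tagged (Btilde_act c b) t) = c * sgval (tagged b t) * c^-1.
Proof. by rewrite epi_compE; apply: wide_conjE. Qed.

(** Conjugating by [y] in [G] and by [z] in [H] is the action of
    [(y^-1, z^-1)], as [Gamma] acts on the left and [x ^ y = y^-1 * x * y]. *)
Lemma Bpair_rel b b' : Btilde_rel b b' <-> Bpair b = Bpair b'.
Proof.
split=> [/existsP[c /eqP ->]|[/outclassP/epi_conjP[y fy] /outclassP/epi_conjP[z gz]]].
  congr pair; apply/outclassP/epi_conjP.
    exists c.1^-1 => t; rewrite !BfstE wide_Btilde_actE /=.
    by rewrite conjgE invgK -mulgA.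
  exists c.2^-1 => t; rewrite !BsndE wide_Btilde_actE /=.
  by rewrite conjgE invgK -mulgA.
apply/existsP; exists (y^-1, z^-1); apply/eqP; apply: wide_Btilde_eq => t.
  rewrite fy !BfstE wide_Btilde_actE /=.
  by rewrite conjgE /= invgK mulgA.
rewrite gz !BsndE wide_Btilde_actE /=.
by rewrite conjgE /= invgK mulgA.
Qed.

Hypothesis U_wide : widely_closed U.

(** The wide subgroup is the image of [T -> G * H]; it belongs to [U] because
    [U] is widely closed. *)
Lemma Bpair_surj p : exists b, Bpair b = p.
Proof.
case: p => f g; have [f0 ->] := outhomP f; have [g0 ->] := outhomP g.
pose h (t : T) : (G * H)%type := (f0 t, g0 t).
have hM : {morph h : s t / s * t} by move=> s t; rewrite /h !epiM.
have gW : group_set (h @: [set: T]).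
  apply/group_setP; split=> [|_ _ /imsetP[s _ ->] /imsetP[t _ ->]].
    by apply/imsetP; exists 1; rewrite ?inE // /h !epi1.
  by apply/imsetP; exists (s * t); rewrite ?inE // hM.
pose W := Group gW.
have hW t : h t \in W by apply: imset_f; rewrite inE.
have WP : wide W && `[< U (subg_of W) >].
  apply/andP; split; last first.
    apply/asboolP; apply: (U_wide (objP G) (objP T) (objP H)) => //.
    by apply/setP => w; apply/imsetP/imsetP => -[t _ ->]; exists t.
  apply/andP; split; apply/eqP/setP => y; rewrite inE; apply/imsetP.
    by have [t <-] := epi_surj f0 y; exists (h t).
  by have [t <-] := epi_surj g0 y; exists (h t).
pose V : Wide G H := exist _ W WP.
pose a (t : T) : wide_obj V := subg W (h t).
have aE t : sgval (a t) = h t by rewrite subgK.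
have aM : {morph a : s t / s * t}.
  by move=> s t; apply/val_inj; rewrite /= !subgK ?groupM // hM.
have aS w : exists t, a t = w.
  have /imsetP[t _ tw] := subgP w; exists t; apply/val_inj.
  by rewrite [LHS]aE -tw.
pose b : Btilde P T :=
  Tagged (fun V => epi T (pf_fam (p := P) V)) (mk_epi aM aS : epi T (wide_obj V)).
have bE t : sgval (tagged b t) = h t.
  by rewrite -aE; congr sgval; apply: mk_epiE.
exists b; congr pair; congr outclass; apply/epiP => t.
  by rewrite BfstE bE.
by rewrite BsndE bE.
Qed.

Definition Borb_pair (q : Borb P T) := Bpair (repr q).

Lemma Borb_pairE b : Borb_pair (Bclass b) = Bpair b.
Proof. by apply/Bpair_rel/BclassP; rewrite /Bclass reprK. Qed.

Lemma Borb_pair_bij : bijective Borb_pair.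
Proof.
have surj p : exists q, Borb_pair q == p.
  by have [b <-] := Bpair_surj p; exists (Bclass b); rewrite Borb_pairE.
exists (fun p => xchoose (surj p)) => [q|p]; last exact/eqP/(xchooseP (surj p)).
have /eqP := xchooseP (surj (Borb_pair q)); move: (xchoose _) => q'.
have [[b ->] [b' ->]] := (BorbP q, BorbP q'); rewrite !Borb_pairE => bb'.
exact/BclassP/Bpair_rel.
Qed.

End Pairs.

Lemma Borb_pair_map (S T : obj U) (f : outhom S T) (q : Borb P T) :
  Borb_pair (Borb_map f q) =
  (outcomp (Borb_pair q).1 f, outcomp (Borb_pair q).2 f).
Proof.
have [b ->] := BorbP q; have [f0 ->] := outhomP f.
rewrite Borb_mapE; last exact: of_outer.
rewrite !Borb_pairE /= !outcompE; congr pair; congr outclass;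
  by apply/epiP => t; rewrite !epi_compE.
Qed.

End WidePairs.

(** * Tensor products of free modules *)

(** The isomorphism of [k[C]] with the tensor product of [k[A]] and [k[B]], for
    a bijection [h] from [C] to [A * B] rather than for [A * B] itself, so that
    it applies to orbit sets without transport. *)
Section FreeTensor.
Variables (k : fieldType) (A B C : finType) (h : C -> A * B).
Hypothesis h_bij : bijective h.
Local Notation kA := {ffun A -> k^o}.
Local Notation kB := {ffun B -> k^o}.

Definition free_to_tensor : {linear {ffun C -> k^o} -> tensor kA kB} :=
  free_lift (fun c => tens (free_basis k (h c).1) (free_basis k (h c).2)).

Lemma free_to_tensor_basis c :
  free_to_tensor (free_basis k c) =
  tens (free_basis k (h c).1) (free_basis k (h c).2).
Proof. exact: free_lift_basis. Qed.

Definition free_mul (x : kA) (y : kB) : {ffun C -> k^o} :=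
  [ffun c => x (h c).1 * y (h c).2].

Fact free_mul_bilinear : bilinear_for *:%R *:%R free_mul.
Proof.
split=> [y a x x'|x a y y'] /=; apply/ffunP => c; rewrite /applyr !ffunE /=.
  by rewrite mulrDl -scalerAl.
by rewrite mulrDr -scalerAr.
Qed.
HB.instance Definition _ := bilinear_isBilinear.Build k kA kB {ffun C -> k^o}
  *:%R *:%R free_mul free_mul_bilinear.

Definition tensor_to_free : {linear tensor kA kB -> {ffun C -> k^o}} :=
  tens_lift free_mul.

Lemma free_to_tensorK : cancel free_to_tensor tensor_to_free.
Proof.
apply: (@free_ext _ _ _ (tensor_to_free \o free_to_tensor) idfun) => c /=.
rewrite [LHS](congr1 tensor_to_free (free_to_tensor_basis c)) [LHS]tens_liftE.
apply/ffunP => d; rewrite !ffunE.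
rewrite -natrM mulnb -(inj_eq (bij_inj h_bij)).
by rewrite [h d]surjective_pairing [h c]surjective_pairing xpair_eqE.
Qed.

Lemma tens_basis_sum (x : kA) (y : kB) :
  tens x y = \sum_(p : A * B)
    (x p.1 * y p.2 : k) *: tens (free_basis k p.1) (free_basis k p.2).
Proof.
rewrite [in LHS](free_basis_sum x) linear_sumlz.
rewrite -(pair_bigA _ (fun a b =>
  (x a * y b : k) *: tens (free_basis k a) (free_basis k b))).
apply: eq_bigr => a _; rewrite [in LHS](free_basis_sum y) linear_sumr.
apply: eq_bigr => b _; rewrite linearZl_LR linearZr_LR.
exact: scalerA.
Qed.

Lemma tensor_to_freeK : cancel tensor_to_free free_to_tensor.
Proof.
apply: (@tensor_ext _ _ _ _ (free_to_tensor \o tensor_to_free) idfun) => x y /=.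
rewrite tens_liftE tens_basis_sum (reindex h) /=; last exact: onW_bij.
by rewrite /free_lift; apply: eq_bigr => c _; rewrite ffunE.
Qed.

End FreeTensor.

(** This reduces the naturality in [T] of the isomorphism of functors to an
    identity between maps of bases. *)
Lemma free_to_tensor_push (k : fieldType) (A B C A' B' C' : finType)
    (h : C -> A * B) (h' : C' -> A' * B')
    (a : A -> A') (b : B -> B') (c : C -> C') :
  (forall q, h' (c q) = (a (h q).1, b (h q).2)) ->
  forall x : {ffun C -> k^o}, free_to_tensor k h' (free_push c x) =
    tens_map (@free_push k _ _ a) (@free_push k _ _ b) (free_to_tensor k h x).
Proof.
move=> hE; apply: (@free_ext _ _ _ (free_to_tensor k h' \o @free_push k _ _ c)
  (tens_map (@free_push k _ _ a) (@free_push k _ _ b) \o free_to_tensor k h)).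
move=> q /=.
rewrite [LHS](congr1 (free_to_tensor k h') (free_push_basis k c q)).
rewrite [RHS](congr1 (tens_map _ _) (free_to_tensor_basis k h q)).
rewrite [RHS]tens_mapE [LHS]free_to_tensor_basis hE /=.
by congr tens; apply/esym/free_push_basis.
Qed.

(** * Tensor products of representable functors *)

Lemma tensor_e_isomorphic (k : fieldType) (U : subcat) (G H : obj U) :
  widely_closed U ->
  isomorphic (rep_tensor (rep_e k G) (rep_e k H)) (rep_F k (wide_family G H)).
Proof.
move=> U_wide; set E := rep_tensor _ _; set F := rep_F k _.
pose f (T : obj U) := free_to_tensor k (@Borb_pair U G H T).
have f_nat (S T : obj U) (u : outhom S T) :
    f S \o rep_map F u =1 rep_map E u \o f T.
  exact: (@free_to_tensor_push k _ _ _ _ _ _ (@Borb_pair U G H T)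
    (@Borb_pair U G H S) (fun g => outcomp g u) (fun g => outcomp g u)
    (Borb_map u) (Borb_pair_map u)).
exact: (@isomorphic_intro k U F E (@RepHom k U F E f f_nat)
  (fun T => tensor_to_free k (@Borb_pair U G H T))
  (fun T => @free_to_tensorK k _ _ _ _ (@Borb_pair_bij U G H T U_wide))
  (fun T => @tensor_to_freeK k _ _ _ _ (@Borb_pair_bij U G H T U_wide))).
Qed.

Theorem proposition4p11 (k : fieldType) (k_char0 : [pchar k] =i pred0)
    (U : subcat) (U_wide : widely_closed U) (G H : obj U) :
  isomorphic (rep_tensor (rep_e k G) (rep_e k H)) (rep_F k (wide_family G H)) /\
  finitely_generated (rep_tensor (rep_e k G) (rep_e k H)) /\
  projective (rep_tensor (rep_e k G) (rep_e k H)).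
Proof.
have iso := tensor_e_isomorphic k G H U_wide.
split=> //; split; first exact/(finitely_generated_iso iso)/rep_F_finitely_generated.
exact/(projective_iso iso)/rep_F_projective.
Qed.
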